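(* Let $U \subset \mathbb{R}^n$ be an open set, let $f : U \to \mathbb{R}$ be a differentiable function, and let $\{\mathbf{x}_k\}_{k=1}^{\infty} \subset U$ be a sequence of vectors satisfying both of the following: (i) there is $\sigma > 0$ such that for all sufficiently large $k$, $f(\mathbf{x}_k) - f(\mathbf{x}_{k+1}) \ge \sigma \|\nabla f(\mathbf{x}_k)\| \, \|\mathbf{x}_{k+1} - \mathbf{x}_k\|$; (ii) for all $k$, $f(\mathbf{x}_k) = f(\mathbf{x}_{k+1})$ implies $\mathbf{x}_k = \mathbf{x}_{k+1}$. Suppose that a cluster point $\mathbf{x}^* \in \mathbb{R}^n$ of the sequence $\{\mathbf{x}_k\}_{k=1}^{\infty}$ admits an open neighborhood $V \subset \mathbb{R}^n$ and constants $\theta \in (0, 1/2]$ and $c \in \mathbb{R}$ such that for all $k$, $$\mathbf{x}_k \in V \quad\implies\quad \left| f(\mathbf{x}_k) - \lim_{j \to \infty} f(\mathbf{x}_j) \right|^{1-\theta} \le c \|\nabla f(\mathbf{x}_k)\| .$$ Then $\mathbf{x}^*$ is the limit of the sequence $\{\mathbf{x}_k\}_{k=1}^{\infty}$.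
   Context: $\|\cdot\|$ is the Euclidean norm. The cluster point $\mathbf{x}^*$ is not assumed to lie in $U$. The displayed hypothesis includes the requirement that $\lim_{j\to\infty} f(\mathbf{x}_j)$ exists as a finite real number. *)

(* Defs.v *)
From HB Require Import structures.
From mathcomp Require Import all_boot all_order all_algebra.
From mathcomp Require Import all_classical all_reals all_analysis.

Set Implicit Arguments.
Unset Strict Implicit.
Unset Printing Implicit Defensive.

Import Order.TTheory GRing.Theory Num.Theory.
Import numFieldNormedType.Exports.

Local Open Scope classical_set_scope.
Local Open Scope ring_scope.

(* The norm [`|u|] that MathComp-Analysis puts on ['rV[R]_n] is the sup norm,
   so the Euclidean norm is defined separately; both induce the same topology. *)
Definition enorm (R : realType) (n : nat) (u : 'rV[R]_n) : R :=
  Num.sqrt (\sum_(i < n) u ord0 i ^+ 2).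

(* [delta_mx ord0 i] is the i-th vector of the standard basis, so the entries
   are the partial derivatives. *)
Definition gradient (R : realType) (n : nat) (f : 'rV[R]_n -> R)
    (p : 'rV[R]_n) : 'rV[R]_n :=
  \row_(i < n) 'D_(delta_mx ord0 i) f p.

(* Main.v *)
Require Import Defs.
From HB Require Import structures.
From mathcomp Require Import all_boot all_order all_algebra.
From mathcomp Require Import all_classical all_reals all_analysis.
From mathcomp Require Import lra.

(** Along the tail the gaps [e_k = f (x_k) - lim_j f (x_j)] decrease to [0].
    Concavity of [t `^ theta] turns the descent condition and the Lojasiewicz
    inequality into [|x_k.+1 - x_k| <= M (e_k `^ theta - e_k.+1 `^ theta)]
    whenever [x_k] lies in [V].  This bound telescopes: started close enough to
    the cluster point and late enough, the sequence can neither leave [V] nor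
    move away from the cluster point. *)

Set Implicit Arguments.
Unset Strict Implicit.
Unset Printing Implicit Defensive.

Import Order.TTheory GRing.Theory Num.Theory.
Import numFieldNormedType.Exports.

Local Open Scope classical_set_scope.
Local Open Scope ring_scope.

(** Young's inequality for [a]^ (1 - t)[and]b [^ t] with the conjugate exponents [(1 - t)^-1] and
    [t^-1]. *)
Lemma weighted_amgm (R : realType) (t a b : R) :
  0 < t < 1 -> 0 <= a -> 0 <= b ->
  a `^ (1 - t) * b `^ t <= (1 - t) * a + t * b.
Proof.
move=> /andP[t0 t1] a0 b0; have s0 : 0 < 1 - t by rewrite subr_gt0.
have := @conjugate_powR R (a `^ (1 - t)) (b `^ t) (1 - t)^-1 t^-1
  (powR_ge0 _ _) (powR_ge0 _ _).
rewrite !invr_gt0 !invrK subrK => /(_ s0 t0 erefl).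
by rewrite -!powRrM !mulfV ?gt_eqF// !powRr1// ![_ * (1 - t)]mulrC [_ * t]mulrC.
Qed.

Lemma powR_concave_tangent (R : realType) (t a b : R) :
  0 < t < 1 -> 0 <= a -> 0 <= b ->
  t * (a - b) <= a `^ (1 - t) * (a `^ t - b `^ t).
Proof.
move=> t01 a0 b0; have := weighted_amgm t01 a0 b0.
have -> : a `^ (1 - t) * (a `^ t - b `^ t) = a - a `^ (1 - t) * b `^ t.
  rewrite mulrBr -powRD ?subrK ?powRr1// oner_eq0; exact.
lra.
Qed.

Lemma lojasiewicz_step (R : realType) (t sigma c a b g d : R) :
  0 < t < 1 -> 0 < sigma -> 0 <= b -> b <= a -> 0 <= g -> 0 <= d ->
  a `^ (1 - t) <= c * g -> sigma * g * d <= a - b -> (a = b -> d = 0) ->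
  d <= `|c| / (sigma * t) * (a `^ t - b `^ t).
Proof.
move=> t01 s0 b0 ba g0 d0 loj desc stat.
have t0 : 0 < t by case/andP: t01.
have [a0|a0] := eqVneq a 0.
  have b_eq0 : b = 0 by apply/eqP; rewrite eq_le b0 -a0 ba.
  by rewrite stat ?a0 ?b_eq0// subrr mulr0.
have agt0 : 0 < a by rewrite lt_neqAle eq_sym a0 (le_trans b0).
have A0 : 0 < a `^ (1 - t) by rewrite powR_gt0.
have := powR_concave_tangent t01 (ltW agt0) b0.
move: (_ `^ (1 - t)) A0 loj => A A0 loj; set D := _ `^ t - _ => tang.
have c0 : 0 < c.
  rewrite ltNge; apply: contraL (lt_le_trans A0 loj) => c0.
  by rewrite -leNgt mulr_le0_ge0.
rewrite gtr0_norm// mulrAC ler_pdivlMr ?mulr_gt0//.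
(* With the factor [A] restored, the chain is: [A] is at most [c * g], descent absorbs [g * d] into
   [a - b], and the tangent bound brings [A] back. *)
rewrite -(ler_pM2l A0).
have h1 : A * (sigma * d * t) <= c * g * (sigma * d * t).
  by rewrite ler_wpM2r// !mulr_ge0// ltW.
have h2 : c * t * (sigma * g * d) <= c * t * (a - b).
  by rewrite ler_wpM2l// mulr_ge0// ltW.
have h3 : c * (t * (a - b)) <= c * (A * D) by rewrite ler_wpM2l// ltW.
lra.
Qed.

(** Carries the Euclidean step bound over to the sup norm, in which convergence is proved. *)
Lemma norm_le_enorm (R : realType) (n : nat) (u : 'rV[R]_n) : `|u| <= enorm u.
Proof.
rewrite {1}/Num.Def.normr/= mx_normrE bigmax_le ?sqrtr_ge0// => -[i j] _ /=.
rewrite -sqrtr_sqr ler_sqrt ?sumr_ge0// => [|k _]; last exact: sqr_ge0.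
by rewrite ord1 (bigD1 j)//= lerDl sumr_ge0// => k _; exact: sqr_ge0.
Qed.

Lemma powR_cvg0 (R : realType) (t : R) (e : nat -> R) :
  0 < t -> (\forall k \near \oo, 0 <= e k) -> e @ \oo --> 0 ->
  (e k `^ t) @[k --> \oo] --> 0.
Proof.
move=> t0 e0 ecvg; apply/cvgrPdist_lt => r r0.
have rt0 : 0 < r `^ t^-1 by rewrite powR_gt0.
move/cvgrPdist_lt: ecvg => /(_ _ rt0) ecvg.
near=> k.
have ek0 : 0 <= e k by near: k.
rewrite sub0r normrN ger0_norm ?powR_ge0//.
have : `|0 - e k| < r `^ t^-1 by near: k.
rewrite sub0r normrN ger0_norm// => /(gt0_ltr_powR t0).
by rewrite -powRrM mulVf ?gt_eqF// powRr1 ?(ltW r0)//; apply; rewrite nnegrE ?powR_ge0.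
Unshelve. all: by end_near. Qed.

(* [phi] plays the role of the remaining path length. *)
Lemma cluster_cvg_of_local_length (R : realType) (W : normedModType R)
    (x : nat -> W) (xs : W) (phi : nat -> R) (r : R) :
  cluster (x @ \oo) xs -> 0 < r ->
  (\forall k \near \oo, 0 <= phi k) -> phi @ \oo --> 0 ->
  (\forall k \near \oo, `|xs - x k| < r ->
     `|x k.+1 - x k| <= phi k - phi k.+1) ->
  x @ \oo --> xs.
Proof.
move=> xs_cluster r0 phi0 phi_cvg step; apply/cvgrPdist_lt => eps eps0.
(* Half of [m] is for the distance from [x k0] to [xs], half for the remaining length [phi k0]. *)
pose m := Num.min eps r; have m0 : 0 < m by rewrite lt_min eps0.
have m20 : 0 < m / 2 by rewrite divr_gt0.
move/cvgrPdist_lt: phi_cvg => /(_ _ m20) phi_small.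
have [N _ HN] : \forall k \near \oo, [/\ 0 <= phi k, `|0 - phi k| < m / 2 &
    `|xs - x k| < r -> `|x k.+1 - x k| <= phi k - phi k.+1].
  by near=> k; split; near: k.
have [_ [[k0 /= Nk0 <-] xk0]] : [set x k | k in [set k | (N <= k)%N]] `&`
    ball xs (m / 2) !=set0.
  apply: xs_cluster; last exact: nbhsx_ballx.
  by exists N => // k /= Nk; exists k.
move: xk0; rewrite -ball_normE /= => xk0.
have [_ phik0 _] := HN _ Nk0.
have close k : (k0 <= k)%N -> `|x k - x k0| <= phi k0 - phi k ->
    `|xs - x k| < m.
  move=> k0k len; have [phik _ _] := HN _ (leq_trans Nk0 k0k).
  have := ler_distD (x k0) xs (x k); rewrite (distrC (x k0)).
  by have := ler_norm (phi k0); move: phik0; rewrite sub0r normrN; lra.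
(* The length bound up to an index keeps that iterate within [r] of [xs] by [close], which licenses
   the next step bound. *)
have len k : (k0 <= k)%N -> `|x k - x k0| <= phi k0 - phi k.
  move=> /subnK <-; elim: (k - k0)%N => [|i IH]; first by rewrite !subrr normr0.
  have k0i : (k0 <= i + k0)%N by rewrite leq_addl.
  have [_ _ /(_ _)] := HN _ (leq_trans Nk0 k0i); rewrite addSn => stepi.
  have := ler_distD (x (i + k0)%N) (x (i + k0).+1) (x k0).
  have : `|xs - x (i + k0)%N| < r.
    by apply: lt_le_trans (close _ k0i IH) _; rewrite ge_min lexx orbT.
  by move=> /stepi; lra.
exists k0 => // k /= k0k.
by apply: lt_le_trans (close _ k0k (len _ k0k)) _; rewrite ge_min lexx.
Unshelve. all: by end_near. Qed.

Theorem theorem1p2 (R : realType) (n : nat)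
    (U : set 'rV[R]_n) (openU : open U)
    (f : 'rV[R]_n -> R)
    (dif : forall p : 'rV[R]_n, U p -> differentiable f p)
    (x : nat -> 'rV[R]_n) (xU : forall k : nat, U (x k))
    (descent : exists2 sigma : R, 0 < sigma &
       \forall k \near \oo,
         f (x k) - f (x k.+1)
           >= sigma * enorm (gradient f (x k)) * enorm (x k.+1 - x k))
    (stationary : forall k : nat, f (x k) = f (x k.+1) -> x k = x k.+1)
    (xstar : 'rV[R]_n) (cluster_xstar : cluster (x @ \oo) xstar)
    (lojasiewicz : exists (V : set 'rV[R]_n) (theta c : R),
       [/\ open_nbhs xstar V,
           0 < theta <= 1 / 2,
           cvg (f (x j) @[j --> \oo]) &
           forall k : nat, V (x k) ->
             `|f (x k) - lim (f (x j) @[j --> \oo])| `^ (1 - theta)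
               <= c * enorm (gradient f (x k))]) :
  x @ \oo --> xstar.
Proof.
have [sigma s0 [K _ desc]] := descent.
have [V [t [c [[openV Vxs] /andP[t0 t12] fcvg loj]]]] := lojasiewicz.
set L := lim _ in loj; pose e k := f (x k) - L.
have t01 : 0 < t < 1 by rewrite t0; lra.
have [r /= r0 rV] : exists2 r : R, 0 < r & ball xstar r `<=` V.
  by apply/nbhs_ballP; exact: open_nbhs_nbhs.
have f_dec k : (K <= k)%N -> f (x k.+1) <= f (x k).
  move=> Kk; rewrite -subr_ge0 (le_trans _ (desc _ Kk))//.
  by rewrite !mulr_ge0 ?sqrtr_ge0// ltW.
have e_ge0 k : (K <= k)%N -> 0 <= e k.
  (* The values decrease from [K] on, so each of them bounds the limit from above. *)
  move=> Kk; rewrite subr_ge0; apply: limr_le => //.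
  exists k => // j /= /subnK <-; elim: (j - k)%N => [//|i].
  by apply: le_trans; rewrite addSn f_dec// (leq_trans Kk) ?leq_addl.
have e_cvg : e @ \oo --> 0.
  by rewrite -(subrr L); apply: cvgB => //; exact: cvg_cst.
have e_near : \forall k \near \oo, 0 <= e k by exists K.
pose M := `|c| / (sigma * t).
have M0 : 0 <= M by rewrite divr_ge0// mulr_ge0// ltW.
apply: (@cluster_cvg_of_local_length _ _ _ _ (fun k => M * e k `^ t) r) => //.
- by near=> k; rewrite mulr_ge0 ?powR_ge0.
- by rewrite -(mulr0 M); apply: cvgMr; exact: powR_cvg0.
exists K => // k /= Kk xkr; rewrite -mulrBr.
apply: le_trans (norm_le_enorm _) _.
apply: (@lojasiewicz_step _ _ _ _ _ _ (enorm (gradient f (x k)))) => //.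
- exact/e_ge0/leqW.
- by rewrite lerD2r f_dec.
- exact: sqrtr_ge0.
- exact: sqrtr_ge0.
- rewrite -{1}(ger0_norm (e_ge0 _ Kk)); apply: loj; apply: rV.
  by rewrite -ball_normE.
- by rewrite opprB addrA subrK; exact: desc.
(* Equal gaps mean equal values of [f], hence equal consecutive iterates. *)
- move=> /addIr/stationary <-.
  by rewrite subrr /enorm big1 ?sqrtr0// => i _; rewrite mxE expr0n.
Unshelve. all: by end_near. Qed.
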